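(* Let $\mathcal{T}^+\ge 0$ and $\mathcal{T}^-\ge 0$ be given real numbers, and put $\mathcal{A}=(b-a)\,\mathcal{T}^+$, $\mathcal{B}=(b-a)\,\mathcal{T}^-$. Then the Cauchy problem $$\dot x(t)=(T^+x)(t)-(T^-x)(t)+f(t),\quad t\in[a,b],\qquad x(a)=c,$$ is uniquely solvable for all linear positive operators $T^+,T^-:\mathbf{C}\to\mathbf{L}_\infty$ with norms $\|T^+\|_{\mathbf{C}\to\mathbf{L}_\infty}=\mathcal{T}^+$ and $\|T^-\|_{\mathbf{C}\to\mathbf{L}_\infty}=\mathcal{T}^-$ if and only if $$(\mathcal{B}^2-\mathcal{A}^2)\,t^2+(\mathcal{A}^2-\mathcal{B}^2+\mathcal{B})\,t+1-\mathcal{A}>0\quad\text{for all } t\in[0,1].$$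
   Context: Fix real numbers $a<b$. $\mathbf{C}=\mathbf{C}[a,b]$ is the Banach space of continuous functions $x:[a,b]\to\mathbb{R}$ with the max norm; $\mathbf{L}=\mathbf{L}[a,b]$ is the space of integrable functions $[a,b]\to\mathbb{R}$; $\mathbf{L}_\infty=\mathbf{L}_\infty[a,b]$ is the space of essentially bounded measurable functions with the essential supremum norm; $\mathbf{AC}=\mathbf{AC}[a,b]$ is the space of absolutely continuous functions. Equalities and inequalities between functions in $\mathbf{L}$ or $\mathbf{L}_\infty$ hold almost everywhere on $[a,b]$. A linear operator $T$ from $\mathbf{C}$ to $\mathbf{L}$ (or $\mathbf{L}_\infty$) is positive if it maps each non-negative continuous function to an almost everywhere non-negative function. With $\mathbf{1}(t)\equiv 1$, the norm of a linear positive operator $T:\mathbf{C}\to\mathbf{L}_\infty$ is $\|T\|_{\mathbf{C}\to\mathbf{L}_\infty}=\operatorname{ess\,sup}_{t\in[a,b]}(T\mathbf{1})(t)$. A solution of the Cauchy problem is a function $x\in\mathbf{AC}$ with $x(a)=c$ satisfying the equation almost everywhere on $[a,b]$. For given $T^+,T^-$ the problem is called uniquely solvable if it has a unique solution for every pair $f\in\mathbf{L}$, $c\in\mathbb{R}$. *)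

(* Defs.v *)
From mathcomp Require Import all_boot all_order all_algebra.
From mathcomp Require Import all_classical all_reals all_analysis.
From mathcomp Require Import ess_sup_inf.

Set Implicit Arguments.
Unset Strict Implicit.
Unset Printing Implicit Defensive.

Import Order.TTheory GRing.Theory Num.Theory.
Import numFieldNormedType.Exports.

Local Open Scope classical_set_scope.
Local Open Scope ring_scope.

(* Functions on [a, b] are represented by total functions R -> R; values
   outside [a, b] never matter.  Elements of L and L_oo are represented by
   Borel-measurable functions (every class has such a representative),
   equalities and inequalities between them being almost everywhere. *)

Notation leb_itv a b := (mrestr lebesgue_measure (measurable_itv `[a, b])).

Definition inC {R : realType} (a b : R) (x : R -> R) : Prop :=
  {within `[a, b], continuous x}.

Definition inL {R : realType} (a b : R) (f : R -> R) : Prop :=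
  (@lebesgue_measure R).-integrable `[a, b] (EFin \o f).

Definition inLoo {R : realType} (a b : R) (f : R -> R) : Prop :=
  measurable_fun `[a, b] f /\ finite_norm (leb_itv a b) +oo%E f.

(* The pairwise disjoint subintervals are ]I_k.1, I_k.2[, possibly empty. *)
Definition inAC {R : realType} (a b : R) (x : R -> R) : Prop :=
  forall e : R, 0 < e -> exists2 d : R, 0 < d &
    forall (n : nat) (I : 'I_n -> R * R),
      (forall k, a <= (I k).1 /\ (I k).1 <= (I k).2 /\ (I k).2 <= b) ->
      trivIset [set: 'I_n] (fun k => `](I k).1, (I k).2[%classic) ->
      \sum_(k < n) ((I k).2 - (I k).1) < d ->
      \sum_(k < n) `|x (I k).2 - x (I k).1| < e.

(* A map T on representatives is an operator C -> L_oo; the first clause says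
   that T x depends only on the restriction of x to [a, b]. *)
Definition is_operator {R : realType} (a b : R) (T : (R -> R) -> R -> R) :
    Prop :=
  (forall x y, inC a b x -> inC a b y -> {in `[a, b], x =1 y} ->
     {ae lebesgue_measure, forall t, t \in `[a, b] -> T x t = T y t}) /\
  (forall x, inC a b x -> inLoo a b (T x)).

Definition is_linear {R : realType} (a b : R) (T : (R -> R) -> R -> R) :
    Prop :=
  forall (r s : R) x y, inC a b x -> inC a b y ->
    {ae lebesgue_measure, forall t, t \in `[a, b] ->
      T (fun u => r * x u + s * y u) t = r * T x t + s * T y t}.

Definition is_positive {R : realType} (a b : R) (T : (R -> R) -> R -> R) :
    Prop :=
  forall x, inC a b x -> {in `[a, b], forall t, 0 <= x t} ->
    {ae lebesgue_measure, forall t, t \in `[a, b] -> 0 <= T x t}.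

Definition linear_positive_operator {R : realType} (a b : R)
    (T : (R -> R) -> R -> R) : Prop :=
  [/\ is_operator a b T, is_linear a b T & is_positive a b T].

(* The norm of a linear positive operator C -> L_oo. *)
Definition opnorm {R : realType} (a b : R) (T : (R -> R) -> R -> R) : \bar R :=
  ess_sup (leb_itv a b) (EFin \o T (cst 1)).

(* Endpoints form a null set, so the two-sided derivative is harmless. *)
Definition is_solution {R : realType} (a b : R) (Tp Tm : (R -> R) -> R -> R)
    (f : R -> R) (c : R) (x : R -> R) : Prop :=
  [/\ inAC a b x, x a = c &
    {ae lebesgue_measure, forall t, t \in `[a, b] ->
      is_derive t 1 x (Tp x t - Tm x t + f t)}].

Definition uniquely_solvable {R : realType} (a b : R)
    (Tp Tm : (R -> R) -> R -> R) : Prop :=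
  forall (f : R -> R) (c : R), inL a b f ->
    exists2 x, is_solution a b Tp Tm f c x &
      forall y, is_solution a b Tp Tm f c y -> {in `[a, b], x =1 y}.

(* Main.v *)
Require Import Defs.
From mathcomp Require Import all_boot all_order all_algebra.
From mathcomp Require Import all_classical all_reals all_analysis.
From mathcomp Require Import ess_sup_inf.
From mathcomp Require Import ring lra.

Set Implicit Arguments.
Unset Strict Implicit.
Unset Printing Implicit Defensive.

Import Order.TTheory GRing.Theory Num.Theory.
Import numFieldNormedType.Exports.
Local Open Scope classical_set_scope.
Local Open Scope ring_scope.

(** Both directions rest on one extremal configuration.  Let x be absolutely
    continuous with x(a) = 0 and x' = Tp x - Tm x, and let M = max x and
    - m = min x, so that M, m >= 0.  Positivity of the operators and the bounds
    Tp 1 <= p, Tm 1 <= q give - (p m + q M) <= x' <= p M + q m almost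
    everywhere.  Suppose that the maximum is attained at t1 and the minimum
    later, at t2.  Integrating x' over [a, t1] and over [t1, t2], and writing
    s = (t1 - a) / (b - a), A = (b - a) p, B = (b - a) q, one gets
      M <= (A M + B m) s   and   M + m <= (A m + B M) (1 - s).
    This linear system has only the solution M = m = 0 as soon as its
    determinant (1 - A s) (1 - A (1 - s)) - B s (B (1 - s) - 1) is positive,
    and that determinant is the quadratic of the theorem ([chiE]).  When the
    minimum comes first, M and m exchange their roles.

    Sufficiency needs existence as well.  The same computation with a
    perturbation h of the right-hand side gives an a priori bound
    |x| <= C sup |h| ([homotopy_bound]), and the constant can be chosen
    uniformly when the operators are multiplied by l in [0, 1], because the
    quadratic then stays away from 0 ([chi_homotopy]).  The method of continuity
    carries solvability from l = 0, where the solution is a primitive of f,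
    to l = 1 in finitely many steps, each of them a contraction on the space of
    continuous functions ([solvable_step]).  No compactness of operators is
    involved.  The passage from a bound on x' to a bound on the increments of x
    is [AC_growth], which is where absolute continuity enters.

    For necessity the extremal configuration is realized by the operators
    x |-> n x(u) on [a, tau], n x(v) on ]tau, b], for which the homogeneous
    problem has piecewise linear solutions.  If A >= 1, the function p (t - a)
    solves x' = p x(a + 1/p).  If A < 1 and the quadratic is not positive
    somewhere on [0, 1], it vanishes at some s > 0, since its value at 0 is
    1 - A > 0; with tau = a + (b - a) s the degenerate linear system above
    yields a nonzero solution of the homogeneous
    problem ([necessary_chi_pos]). *)

(** * Continuity and absolute continuity on a segment *)

Lemma inCP (R : realType) (a b : R) (x : R -> R) :
  inC a b x <-> forall t e, t \in `[a, b] -> 0 < e -> exists2 d, 0 < d &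
    forall s, s \in `[a, b] -> `|s - t| < d -> `|x s - x t| < e.
Proof.
split.
- move=> /subspace_continuousP cx t e tab e0.
  have := cx t tab => /cvgrPdist_lt /(_ _ e0) /= /nbhs_ballP[d /= d0 H].
  exists d => // s sab sd; rewrite distrC; apply: H => //=.
  by rewrite /ball/= distrC.
- move=> H; apply/subspace_continuousP => t tab.
  apply/cvgrPdist_lt => e e0; have [d d0 Hd] := H t e tab e0.
  apply/nbhs_ballP; exists d => //= s sd sab.
  by rewrite distrC; apply: Hd => //; rewrite distrC.
Qed.

Lemma AC_inC (R : realType) (a b : R) (x : R -> R) : inAC a b x -> inC a b x.
Proof.
move=> ACx; apply/inCP => t e; rewrite in_itv/= => /andP[at_ tb] e0.
have [d d0 Hd] := ACx e e0; exists d => // s; rewrite in_itv/= => /andP[as_ sb].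
have osc u v : a <= u -> u <= v -> v <= b -> v - u < d -> `|x v - x u| < e.
  move=> au uv vb uvd.
  have := Hd 1%N (fun=> (u, v)); rewrite !big_ord1/=; apply => //.
  by move=> i j _ _ _; rewrite (ord1 i) (ord1 j).
have [st|ts] := leP s t.
- rewrite (distrC s) ger0_norm ?subr_ge0// distrC => ?; exact: osc.
- rewrite ger0_norm ?subr_ge0 ?ltW// => ?; apply: osc => //; exact: ltW.
Qed.

Lemma inC_cst (R : realType) (a b c : R) : inC a b (cst c).
Proof.
by apply/inCP => t e _ e0; exists 1 => // s _ _; rewrite subrr normr0.
Qed.

Lemma inC_lin (R : realType) (a b : R) (r s : R) (x y : R -> R) :
  inC a b x -> inC a b y -> inC a b (fun u => r * x u + s * y u).
Proof.
have scale (k : R) z : inC a b z -> inC a b (fun u => k * z u).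
  move=> /inCP cz; apply/inCP => t e tab e0.
  have k1 : 0 < `|k| + 1 by rewrite ltr_wpDl.
  have [d d0 H] := cz t (e / (`|k| + 1)) tab (divr_gt0 e0 k1).
  exists d => // u uab ud; rewrite -mulrBr normrM.
  apply: le_lt_trans (_ : _ <= (`|k| + 1) * `|z u - z t|) _.
    by rewrite ler_wpM2r// lerDl.
  by rewrite mulrC -ltr_pdivlMr//; exact: H.
move=> /(scale r)/inCP cx /(scale s)/inCP cy; apply/inCP => t e tab e0.
have e2 : 0 < e / 2 by rewrite divr_gt0.
have [d1 d10 H1] := cx t _ tab e2; have [d2 d20 H2] := cy t _ tab e2.
exists (Num.min d1 d2); first by rewrite lt_min d10.
move=> u uab; rewrite lt_min => /andP[/(H1 u uab) h1 /(H2 u uab) h2].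
rewrite (_ : _ - _ = (r * x u - r * x t) + (s * y u - s * y t)); last by ring.
by rewrite (splitr e) (le_lt_trans (ler_normD _ _))// ltrD.
Qed.

Lemma lipschitz_AC (R : realType) (a b k : R) (x : R -> R) :
  (forall s t, a <= s -> s <= t -> t <= b -> `|x t - x s| <= k * (t - s)) ->
  inAC a b x.
Proof.
move=> lip e e0; have k1 : 0 < `|k| + 1 by rewrite ltr_wpDl.
exists (e / (`|k| + 1)); first exact: divr_gt0.
move=> n I Iab _; rewrite ltr_pdivlMr// mulrC; apply: le_lt_trans.
rewrite mulr_sumr; apply: ler_sum => i _; have [ai [ii ib]] := Iab i.
apply: le_trans (lip _ _ ai ii ib) _; rewrite ler_wpM2r ?subr_ge0//.
by rewrite (le_trans (ler_norm _))// lerDl.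
Qed.

Lemma AC_lin (R : realType) (a b : R) (r s : R) (x y : R -> R) :
  inAC a b x -> inAC a b y -> inAC a b (fun u => r * x u + s * y u).
Proof.
have scale (k : R) z : inAC a b z -> inAC a b (fun u => k * z u).
  move=> cz e e0; have k1 : 0 < `|k| + 1 by rewrite ltr_wpDl.
  have [d d0 H] := cz (e / (`|k| + 1)) (divr_gt0 e0 k1).
  exists d => // n I I1 I2 I3; have := H n I I1 I2 I3.
  rewrite ltr_pdivlMr// mulrC; apply: le_lt_trans.
  rewrite mulr_sumr; apply: ler_sum => i _; rewrite -mulrBr normrM.
  by rewrite ler_wpM2r// lerDl.
move=> /(scale r) cx /(scale s) cy e e0.
have e2 : 0 < e / 2 by rewrite divr_gt0.
have [d1 d10 H1] := cx _ e2; have [d2 d20 H2] := cy _ e2.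
exists (Num.min d1 d2); first by rewrite lt_min d10.
move=> n I I1 I2; rewrite lt_min.
move=> /andP[/(H1 n I I1 I2) h1 /(H2 n I I1 I2) h2].
rewrite (splitr e); apply: le_lt_trans (ltrD h1 h2).
rewrite -big_split/=; apply: ler_sum => i _; rewrite opprD addrACA.
exact: ler_normD.
Qed.

(** Cousin's lemma as an induction principle: the supremum of the points up to
    which [P] propagates can neither be missed from the left nor be exceeded. *)
Lemma cousin_induction (R : realType) (P : R -> Prop) (s t : R) : s <= t ->
  P s ->
  (forall z, s <= z <= t -> exists2 d, 0 < d & forall u v, s <= u -> u <= z ->
    z <= v -> v <= t -> z - d < u -> v < z + d -> P u -> P v) ->
  P t.
Proof.
move=> st Ps step.
pose S := [set u | s <= u <= t /\ P u].
have Ss : S s by split=> //; rewrite lexx st.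
have hS : has_sup S by split; [exists s|exists t => u [/andP[]]].
have ub u : S u -> u <= sup S by move=> Su; apply: ub_le_sup => //; case: hS.
have zst : s <= sup S <= t.
  by rewrite ub//= ge_sup//; [exists s|move=> u [/andP[]]].
have [d d0 H] := step _ zst.
have [u [/andP[su ut] Pu] zu] := sup_adherent d0 hS.
have uz : u <= sup S by apply: ub; split => //; rewrite su.
case/andP: zst => sz zt.
pose v := Num.min t (sup S + d / 2).
have zv : sup S <= v by rewrite le_min zt lerDl divr_ge0// ltW.
have Pv : P v.
  apply: (H u v) => //; first by rewrite ge_min lexx.
  rewrite gt_min ltrD2l; apply/orP; right.
  by rewrite gtr_pMr// invf_lt1// ltr1n.
have : v <= sup S.
  by apply: ub; split => //; rewrite (le_trans sz zv)/= ge_min lexx.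
rewrite ge_min => /orP[tz|]; last by rewrite gerDl leNgt divr_gt0.
by move: Pv; rewrite /v min_l// (le_trans tz)// lerDl divr_ge0// ltW.
Qed.

Lemma measure_disjoint_itvs (R : realType) (n : nat) (I : 'I_n -> R * R) :
  (forall k, (I k).1 <= (I k).2) ->
  trivIset [set: 'I_n] (fun k => `](I k).1, (I k).2[%classic) ->
  lebesgue_measure (\big[setU/set0]_(k < n) `](I k).1, (I k).2[%classic) =
  (\sum_(k < n) ((I k).2 - (I k).1))%:E.
Proof.
move=> I12 tI; rewrite measure_semi_additive_ord//; last first.
  exact: bigsetU_measurable.
rewrite -sumEFin; apply: eq_bigr => i _.
rewrite /= lebesgue_measure_itv/= lte_fin; case: ltP => // h.
by rewrite (@le_anti _ _ (I i).2 (I i).1) ?subrr// h I12.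
Qed.

Lemma ae_mono2 (R : realType) (P Q S : R -> Prop) :
  (forall t, P t -> Q t -> S t) ->
  {ae lebesgue_measure, forall t, P t} ->
  {ae lebesgue_measure, forall t, Q t} ->
  {ae lebesgue_measure, forall t, S t}.
Proof.
move=> PQS; apply: filterS2 => //.
exact: (ae_filter_ringOfSetsType lebesgue_measure).
Qed.

Lemma ae_mono (R : realType) (P S : R -> Prop) : (forall t, P t -> S t) ->
  {ae lebesgue_measure, forall t, P t} -> {ae lebesgue_measure, forall t, S t}.
Proof.
move=> PS; apply: filterS => //.
exact: (ae_filter_ringOfSetsType lebesgue_measure).
Qed.

Lemma ae_neq (R : realType) (c : R) :
  {ae lebesgue_measure, forall t : R, t != c}.
Proof.
exists [set c]; split => //; first exact: lebesgue_measure_set1.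
by move=> t /= /negP; rewrite negbK => /eqP.
Qed.

(** * A mean value inequality for absolutely continuous functions *)

Lemma is_derive_little_o (R : realType) (x : R -> R) (t d e : R) :
  is_derive t 1 x d -> 0 < e ->
  exists2 r, 0 < r & forall u, `|u - t| < r ->
    `|x u - x t - d * (u - t)| <= e * `|u - t|.
Proof.
move=> [dx <-] e0.
have /cvgrPdist_lt /(_ _ e0) /nbhs_ballP[r /= r0 H] :
    (fun h => h^-1 *: (x (h *: 1 + t) - x t)) @ 0^' --> 'D_1 x t by exact: dx.
exists r => // u ur; have [->|ut] := eqVneq u t.
  by rewrite !subrr mulr0 subr0 normr0 mulr0.
have ut0 : u - t != 0 by rewrite subr_eq0.
have := H (u - t); rewrite /ball/= sub0r normrN => /(_ ur ut0).
rewrite /GRing.scale/= mulr1 subrK => h.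
have -> : x u - x t - 'D_1 x t * (u - t) =
  - ('D_1 x t - (u - t)^-1 * (x u - x t)) * (u - t).
  by rewrite opprB mulrBl mulrAC mulVf// mul1r.
by rewrite normrM normrN ler_wpM2r// ltW.
Qed.

(** The points where the bound on the derivative fails form a null set, covered
    by an open set U of small measure.  A Cousin induction splits [s, t] into
    small intervals: around a good point the increment of x is controlled by the
    derivative, around a bad point the interval lies in U.  The intervals of the
    second kind are disjoint and have small total length, so by absolute
    continuity they contribute little.  The sign of [L] lets the good intervals
    be charged with the whole length t - s. *)
Lemma AC_growth (R : realType) (a b : R) (x dx : R -> R) (L : R) :
  inAC a b x -> 0 <= L ->
  {ae lebesgue_measure, forall t, t \in `[a, b] -> is_derive t 1 x (dx t)} ->
  {ae lebesgue_measure, forall t, t \in `[a, b] -> dx t <= L} ->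
  forall s t, a <= s -> s <= t -> t <= b -> x t - x s <= L * (t - s).
Proof.
move=> ACx L0 dxE dxL s t as_ st tb.
apply/ler_addgt0Pr => e0 e0_gt0.
(* chosen so that e (t - s) + e = e0 *)
pose e := e0 / (t - s + 1).
have ts1 : 0 < t - s + 1 by rewrite ltr_wpDl// subr_ge0.
have e_gt0 : 0 < e by exact: divr_gt0.
suff : x t - x s <= (L + e) * (t - s) + e.
  move/le_trans; apply; rewrite mulrDl -addrA lerD2l -[X in _ + X]mulr1 -mulrDr.
  by rewrite /e divfK// gt_eqF.
have [d d0 Hd] := ACx e e_gt0.
have [N [mN N0 Nbad]] : lebesgue_measure.-negligible
    (~` [set t | t \in `[a, b] -> is_derive t 1 x (dx t) /\ dx t <= L]).
  by apply: ae_mono2 dxE dxL => z h1 h2 zab; split; [exact: h1|exact: h2].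
have [U [oU NU muU]] : exists U : set R,
    [/\ open U, N `<=` U & (lebesgue_measure U < d%:E)%E].
  have N_fin : (lebesgue_measure N < +oo)%E by rewrite N0.
  have [U [oU NU muU]] := lebesgue_regularity_outer mN N_fin d0.
  exists U; split => //.
  rewrite -(setDUK NU) measureU//; last 2 first.
  - by apply: measurableD => //; exact: measurable_realfun.open_measurable.
  - by rewrite setDE setICA setICr setI0.
  by rewrite [X in (X + _)%E]N0 add0e.
(* The family I collects the intervals of a subdivision of [s, u] that are built
   around exceptional points; they are listed from left to right. *)
pose P u := exists n (I : nat -> R * R),
  [/\ forall k, (k < n)%N -> [/\ s <= (I k).1, (I k).1 <= (I k).2,
          (I k).2 <= u & `](I k).1, (I k).2[ `<=` U],
      forall i j, (i < j < n)%N -> (I i).2 <= (I j).1 &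
      x u - x s <= (L + e) * (u - s) + \sum_(k < n) `|x (I k).2 - x (I k).1|].
have [n [I [I1 I2 xts]]] : P t.
  apply: (@cousin_induction _ P s t st).
  - exists 0%N, (fun=> (s, s)); split => //.
    by rewrite !subrr mulr0 big_ord0 addr0.
  - move=> z /andP[sz zt].
    have [zN|zN] := pselect (N z).
    (* near an exceptional point, ]u, v[ joins the family *)
    + have /nbhs_ballP[r /= r0 rU] : nbhs z U.
        by apply: open_nbhs_nbhs; split => //; exact: NU.
      exists r => // u v su uz zv vt zu vz [n [I [I1 I2 xu]]].
      exists n.+1, (fun k => if (k < n)%N then I k else (u, v)); split.
      * move=> k; rewrite ltnS leq_eqVlt => /orP[/eqP ->|kn].
          rewrite ltnn; split => //=; first exact: le_trans zv.
          move=> y; rewrite /= in_itv/= => /andP[uy yv]; apply: rU.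
          rewrite ball_itv/= in_itv/= (lt_trans zu uy)/=.
          exact: lt_trans vz.
        rewrite kn; have [? ? ? ?] := I1 k kn; split => //.
        by rewrite (le_trans _ (le_trans uz zv)).
      * move=> i j /andP[ij]; rewrite ltnS leq_eqVlt => /orP[/eqP jn|jn].
          by move: ij; rewrite jn ltnn => ij; rewrite ij; have [] := I1 i ij.
        by rewrite jn (ltn_trans ij jn); apply: I2; rewrite ij.
      * rewrite big_ord_recr/= ltnn/=.
        under eq_bigr do rewrite ltn_ord.
        rewrite (_ : x v - x s = (x u - x s) + (x v - x u)); last by ring.
        apply: le_trans (lerD xu (ler_norm _)) _.
        rewrite addrA !lerD2r ler_wpM2l//; first by rewrite addr_ge0// ltW.
        by rewrite lerD2r (le_trans uz).
    + have [xz dxz] : is_derive z 1 x (dx z) /\ dx z <= L.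
        apply: contrapT => nd; apply: zN; apply: Nbad => /= H.
        apply: nd; apply: H.
        by rewrite in_itv/= (le_trans as_ sz) (le_trans zt).
      have [r r0 xr] := is_derive_little_o xz e_gt0.
      exists r => // u v su uz zv vt zu vz [n [I [I1 I2 xu]]].
      exists n, I; split => //.
        move=> k kn; have [? ? ? ?] := I1 k kn; split => //.
        by rewrite (le_trans _ (le_trans uz zv)).
      have hv : x v - x z <= (L + e) * (v - z).
        have := xr v; rewrite ger0_norm ?subr_ge0// ltrBlDl => /(_ vz).
        move/(le_trans (ler_norm _)).
        rewrite lerBlDl => /le_trans; apply.
        by rewrite -mulrDl ler_wpM2r ?subr_ge0// lerD2r.
      have hu : x z - x u <= (L + e) * (z - u).
        have := xr u; rewrite distrC ger0_norm ?subr_ge0//.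
        rewrite ltrBlDl -ltrBlDr => /(_ zu).
        rewrite ler_norml => /andP[+ _].
        have : dx z * (z - u) <= L * (z - u) by rewrite ler_wpM2r ?subr_ge0.
        by rewrite mulrDl; lra.
      have -> : x v - x s = (x u - x s) + (x z - x u) + (x v - x z) by ring.
      apply: le_trans (lerD (lerD xu hu) hv) _.
      by rewrite le_eqVlt; apply/orP; left; apply/eqP; ring.
apply: (le_trans xts); rewrite lerD2l ltW//.
have tI : trivIset [set: 'I_n] (fun k : 'I_n => `](I k).1, (I k).2[%classic).
  suff lt_disj (i j : 'I_n) : (i < j)%N -> forall y,
      `](I i).1, (I i).2[%classic y -> `](I j).1, (I j).2[%classic y -> False.
    move=> i j _ _ [y [yi yj]]; case: (ltngtP i j) => [ij|ji|/val_inj//].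
    - by have := lt_disj _ _ ij _ yi yj.
    - by have := lt_disj _ _ ji _ yj yi.
  move=> ij y; rewrite /= !in_itv/= => /andP[_ yi] /andP[yj _].
  have := I2 i j; rewrite ij ltn_ord => /(_ isT).
  by rewrite leNgt (lt_trans yj yi).
apply: (Hd n (fun k => I k)) => //.
- move=> k; have [? ? ? ?] := I1 k (ltn_ord k).
  split; first exact: le_trans as_ _.
  by split => //; exact: le_trans tb.
- rewrite -lte_fin -measure_disjoint_itvs//; last first.
    by move=> k; have [] := I1 k (ltn_ord k).
  apply: le_lt_trans muU; apply: le_measure; rewrite ?inE//.
  + exact: bigsetU_measurable.
  + exact: measurable_realfun.open_measurable.
  + elim/big_ind: _ => // [A B AU BU|k _]; first by rewrite subUset.
    by have [] := I1 k (ltn_ord k).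
Qed.

(** * Primitives of integrable functions *)

(** Lebesgue differentiation gives the derivative; absolute continuity is that
    of the integral as a function of the set of integration.  Cutting f off
    outside [a, b] makes it integrable on the whole line. *)
Lemma AC_primitive (R : realType) (a b : R) (f : R -> R) : inL a b f ->
  let F := fun t =>
    (\int[lebesgue_measure]_(s in `[a, t]) (f \_ `[a, b]) s)%R in
  inAC a b F /\
  {ae lebesgue_measure, forall t, t \in `[a, b] -> is_derive t 1 F (f t)}.
Proof.
set g := f \_ `[a, b] => fL F.
have gL : lebesgue_measure.-integrable setT (EFin \o g).
  by move: fL; rewrite /inL integrable_mkcond//= restrict_EFin.
have gLA A : measurable A -> lebesgue_measure.-integrable A (EFin \o g).
  by move=> mA; apply: integrableS gL.
split; last first.
  have := @FTC1 R g (BLeft a) (fun y => gLA _ (measurable_itv _))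
    (integrable_locally_restrict (measurable_itv _) fL).
  move/ae_mono2; apply; last exact: (ae_neq a).
  move=> t FTC ta tab; have [|dF F't] := FTC.
    by move: tab; rewrite in_itv/= lte_fin lt_neqAle eq_sym ta => /andP[].
  by split => //; rewrite -derive1E F't /g patchE mem_set.
move=> e e0; have [d [d0 Hd]] := integral_normr_continuous gL e0.
exists d => // n I Iab tI Id.
rewrite -lte_fin -measure_disjoint_itvs// in Id; last first.
  by move=> k; have [_ []] := Iab k.
set A := \big[setU/set0]_(k < n) _ in Id.
have mA : measurable A by exact: bigsetU_measurable.
apply: le_lt_trans (Hd A mA Id).
rewrite -lee_fin /Rintegral fineK; last first.
  by apply: integrable_fin_num => //; exact: integrable_abse (gLA _ mA).
rewrite ge0_integral_bigsetU//=; last 3 first.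
- exact: index_enum_uniq.
- by move: tI; apply: sub_trivIset.
- exact: measurable_int (integrable_abse (gLA _ mA)).
rewrite -sumEFin; apply: lee_sum => k _.
have [ak [Ik kb]] := Iab k.
rewrite /F Rintegral_itvB//=; last exact: (gLA _ (measurable_itv _)).
rewrite -Rintegral_itv_bndo_bndc; last exact: (gLA _ (measurable_itv _)).
apply: (@le_trans _ _
    (\int[lebesgue_measure]_(t in `](I k).1, (I k).2[) `|g t|)%:E).
  by rewrite lee_fin; apply: le_normr_Rintegral => //; exact: gLA.
rewrite /Rintegral fineK//; apply: integrable_fin_num => //.
exact: integrable_abse (gLA _ (measurable_itv _)).
Qed.

(** * The extremal linear system and the a priori bound *)

(** The determinant of the extremal system, in the expanded form of the
    theorem; [chiE] is the form in which it arises. *)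
Definition chi (R : realType) (A B t : R) : R :=
  (B ^+ 2 - A ^+ 2) * t ^+ 2 + (A ^+ 2 - B ^+ 2 + B) * t + 1 - A.

Lemma chiE (R : realType) (A B t : R) :
  chi A B t =
  (1 - A * t) * (1 - A * (1 - t)) - B * t * (B * (1 - t) - 1).
Proof. by rewrite /chi; ring. Qed.

(** Eliminate one unknown.  If k = B (1 - s) - 1 is nonnegative, multiplying the
    first inequality by 1 - A (1 - s) >= 0 and inserting the second leaves the
    determinant as the coefficient of [M].  If k < 0, the second inequality
    bounds [m] by itself. *)
Lemma extremal_system_bound (R : realType) (A B e M m s d : R) :
  0 <= A -> 0 <= B -> 0 <= e -> 0 <= M -> 0 <= m -> 0 <= s <= 1 ->
  0 < d -> d <= 1 - A -> d <= chi A B s ->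
  M <= (A * M + B * m + e) * s ->
  M + m <= (A * m + B * M + e) * (1 - s) ->
  d ^+ 2 * M <= (1 + B) ^+ 2 * e /\ d ^+ 2 * m <= (1 + B) ^+ 2 * e.
Proof.
move=> A0 B0 e0 M0 m0 /andP[s0 s1] d0 dA; rewrite chiE => dchi h1 h2.
have t0 : 0 <= 1 - s by rewrite subr_ge0.
set a1 := 1 - A * s in dchi; set a2 := 1 - A * (1 - s) in dchi.
set k := B * (1 - s) - 1 in dchi.
have As : A * s <= A by rewrite ler_piMr.
have At : A * (1 - s) <= A by rewrite ler_piMr// gerBl.
have Bs : B * s <= B by rewrite ler_piMr.
have Bt : B * (1 - s) <= B by rewrite ler_piMr// gerBl.
have Bs0 : 0 <= B * s by rewrite mulr_ge0.
have da1 : d <= a1 by rewrite /a1; lra.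
have da2 : d <= a2 by rewrite /a2; lra.
have a21 : a2 <= 1 by rewrite gerBl mulr_ge0.
have es : e * s <= e by rewrite ler_piMr.
have et : e * (1 - s) <= e by rewrite ler_piMr// gerBl.
have {}h1 : M * a1 <= B * s * m + e by rewrite /a1; lra.
have {}h2 : m * a2 <= M * k + e by rewrite /a2 /k; lra.
have d1 : d <= 1 by lra.
have BM0 : 0 <= B * M by rewrite mulr_ge0.
have Bm0 : 0 <= B * m by rewrite mulr_ge0.
have Be0 : 0 <= B * e by rewrite mulr_ge0.
have BBe0 : 0 <= B * (B * e) by rewrite mulr_ge0.
have -> : (1 + B) ^+ 2 * e = e + 2 * (B * e) + B * (B * e) by ring.
have de : d * e <= e by rewrite ler_piMl.
have dm : d * m <= m * a2 by rewrite mulrC ler_wpM2l.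
have dM : d * M <= M * a1 by rewrite mulrC ler_wpM2l.
have [k0|k0] := leP 0 k.
- have dM1 : d * M <= (1 + B) * e.
    have : M * (a1 * a2 - B * s * k) <= B * s * e + e.
      have : M * a1 * a2 <= (B * s * m + e) * a2.
        by rewrite ler_wpM2r// (le_trans _ da2)// ltW.
      have : B * s * (m * a2) <= B * s * (M * k + e) by rewrite ler_wpM2l.
      have : e * a2 <= e by rewrite ler_piMr.
      lra.
    have : d * M <= M * (a1 * a2 - B * s * k) by rewrite mulrC ler_wpM2l.
    have : B * s * e <= B * e by rewrite ler_wpM2r.
    lra.
  have dm1 : d * m <= B * M + e.
    have : M * k <= M * B by rewrite ler_wpM2l// /k; lra.
    lra.
  have h3 : d * (d * M) <= d * ((1 + B) * e) by rewrite ler_wpM2l// ltW.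
  have h4 : d * (d * m) <= d * (B * M + e) by rewrite ler_wpM2l// ltW.
  have h5 : B * (d * M) <= B * ((1 + B) * e) by rewrite ler_wpM2l.
  have h6 : d * (B * e) <= B * e by rewrite ler_piMl.
  by split; rewrite expr2 -mulrA; lra.
- have dm1 : d * m <= e.
    have : M * k <= 0 by rewrite mulr_ge0_le0// ltW.
    lra.
  have dM1 : d * M <= B * m + e.
    have : B * s * m <= B * m by rewrite ler_wpM2r.
    lra.
  have h3 : d * (d * M) <= d * (B * m + e) by rewrite ler_wpM2l// ltW.
  have h4 : d * (d * m) <= d * e by rewrite ler_wpM2l// ltW.
  have h5 : B * (d * m) <= B * e by rewrite ler_wpM2l.
  by split; rewrite expr2 -mulrA; lra.
Qed.

Lemma AC_opp (R : realType) (a b : R) (x : R -> R) :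
  inAC a b x -> inAC a b (fun u => - x u).
Proof.
move=> ACx e e0; have [d d0 H] := ACx e e0; exists d => // n I I1 I2 I3.
apply: le_lt_trans (H n I I1 I2 I3); apply: ler_sum => i _.
by rewrite -opprD normrN.
Qed.

(** The increments of [w] from a to its first extremum and between its two
    extrema satisfy the extremal system, with s the relative position of the
    first extremum.  The hypothesis on [dw] is what positivity of the operators
    gives for the perturbed equation. *)
Lemma apriori_bound (R : realType) (a b p q eps d : R) (w dw : R -> R) :
  a < b -> 0 <= p -> 0 <= q -> 0 <= eps -> 0 < d ->
  let A := (b - a) * p in let B := (b - a) * q in
  (forall s, 0 <= s <= 1 -> d <= chi A B s) ->
  inAC a b w -> w a = 0 ->
  {ae lebesgue_measure, forall t, t \in `[a, b] -> is_derive t 1 w (dw t)} ->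
  (forall M m, 0 <= M -> 0 <= m -> {in `[a, b], forall t, - m <= w t <= M} ->
    {ae lebesgue_measure, forall t, t \in `[a, b] ->
      - (p * m + q * M + eps) <= dw t <= p * M + q * m + eps}) ->
  {in `[a, b], forall t,
    `|w t| <= (1 + B) ^+ 2 / d ^+ 2 * ((b - a) * eps)}.
Proof.
move=> ab p0 q0 eps0 d0 A B dchi ACw wa dwE dw_bound.
have [t1 t1ab maxw] := EVT_max (ltW ab) (AC_inC ACw).
have [t2 t2ab minw] := EVT_min (ltW ab) (AC_inC ACw).
have aab : a \in `[a, b] by rewrite in_itv/= lexx ltW.
pose M := w t1; pose m := - w t2.
have M0 : 0 <= M by rewrite -wa maxw.
have m0 : 0 <= m by rewrite /m oppr_ge0 -wa minw.
have /(dw_bound _ _ M0 m0) dwMm : {in `[a, b], forall t, - m <= w t <= M}.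
  by move=> t tab; rewrite opprK minw//= maxw.
have K1 : 0 <= p * M + q * m + eps by rewrite !addr_ge0 ?mulr_ge0.
have K2 : 0 <= p * m + q * M + eps by rewrite !addr_ge0 ?mulr_ge0.
have up : forall s t, a <= s -> s <= t -> t <= b ->
    w t - w s <= (p * M + q * m + eps) * (t - s).
  apply: AC_growth ACw K1 dwE _.
  by apply: ae_mono dwMm => u h uab; case/andP: (h uab).
have dwNE : {ae lebesgue_measure, forall t, t \in `[a, b] ->
    is_derive t 1 (fun u => - w u) (- dw t)}.
  by apply: ae_mono dwE => t h tab; have := h tab => ?; exact: is_deriveN.
have down : forall s t, a <= s -> s <= t -> t <= b ->
    w s - w t <= (p * m + q * M + eps) * (t - s).
  move=> s t as_ st tb; rewrite -[w s]opprK addrC.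
  apply: AC_growth (AC_opp ACw) K2 dwNE _ _ _ as_ st tb.
  by apply: ae_mono dwMm => u h uab; rewrite lerNl; case/andP: (h uab).
move: t1ab t2ab; rewrite !in_itv/= => /andP[at1 t1b] /andP[at2 t2b].
have ba0 : 0 < b - a by rewrite subr_gt0.
have dA : d <= 1 - A.
  by have := dchi 0; rewrite lexx ler01 chiE => /(_ isT); lra.
have A0 : 0 <= A by rewrite mulr_ge0// ltW.
have B0 : 0 <= B by rewrite mulr_ge0// ltW.
have e0 : 0 <= (b - a) * eps by rewrite mulr_ge0// ltW.
have key (M' m' t : R) : 0 <= M' -> 0 <= m' -> a <= t <= b ->
    M' <= (p * M' + q * m' + eps) * (t - a) ->
    M' + m' <= (p * m' + q * M' + eps) * (b - t) ->
    d ^+ 2 * M' <= (1 + B) ^+ 2 * ((b - a) * eps) /\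
    d ^+ 2 * m' <= (1 + B) ^+ 2 * ((b - a) * eps).
  move=> M'0 m'0 /andP[at_ tb] h1 h2; pose s := (t - a) / (b - a).
  have sE : (b - a) * s = t - a by rewrite mulrC divfK// gt_eqF.
  have s01 : 0 <= s <= 1.
    rewrite divr_ge0 ?(ltW ba0) ?subr_ge0//=.
    by rewrite ler_pdivrMr// mul1r lerD2r.
  apply: (@extremal_system_bound _ A B _ _ _ s) => //; first exact: dchi.
  - by apply: (le_trans h1); rewrite -sE /A /B; lra.
  - apply: (le_trans h2); rewrite (_ : b - t = (b - a) * (1 - s)).
      by rewrite /A /B; lra.
    by rewrite mulrBr mulr1 sE; ring.
have [MC mC] : d ^+ 2 * M <= (1 + B) ^+ 2 * ((b - a) * eps) /\
    d ^+ 2 * m <= (1 + B) ^+ 2 * ((b - a) * eps).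
  have [t12|/ltW t21] := leP t1 t2.
  - apply: (key M m t1) => //; first by rewrite at1.
      by have := up a t1; rewrite wa subr0; apply.
    by apply: le_trans (down t1 t2 at1 t12 t2b) _; rewrite ler_wpM2l// lerD2r.
  - apply/and_comm; apply: (key m M t2) => //; first by rewrite at2.
      by have := down a t2; rewrite wa sub0r; apply.
    rewrite addrC; apply: le_trans (up t2 t1 at2 t21 t1b) _.
    by rewrite ler_wpM2l// lerD2r.
move=> t tab; rewrite mulrAC ler_pdivlMr ?exprn_gt0// mulrC.
have [wt0|wt0] := leP 0 (w t).
  rewrite ger0_norm//; apply: le_trans MC.
  by rewrite ler_wpM2l ?exprn_ge0 ?(ltW d0)//; exact: maxw.
rewrite ltr0_norm//; apply: le_trans mC.
by rewrite ler_wpM2l ?exprn_ge0 ?(ltW d0)// lerN2; exact: minw.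
Qed.

(** * Fixed points in the space of continuous functions *)

Lemma inC_bounded (R : realType) (a b : R) (x : R -> R) : a < b -> inC a b x ->
  exists2 k, 0 <= k & {in `[a, b], forall t, `|x t| <= k}.
Proof.
move=> ab cx.
have [t1 _ maxx] := EVT_max (ltW ab) cx.
have [t2 _ minx] := EVT_min (ltW ab) cx.
exists (`|x t1| + `|x t2|); first by rewrite addr_ge0.
move=> t tab; have := maxx t tab; have := minx t tab.
have := ler_norm (x t1); have := ler_norm (- x t2); rewrite normrN.
have := normr_ge0 (x t1); have := normr_ge0 (x t2).
by rewrite ler_norml => *; apply/andP; split; lra.
Qed.

Lemma inC_uniform_limit (R : realType) (a b : R) (X : nat -> R -> R)
  (x : R -> R) :
  (forall n, inC a b (X n)) ->
  (forall e, 0 < e -> exists n, {in `[a, b], forall t, `|X n t - x t| <= e}) ->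
  inC a b x.
Proof.
move=> cX Xx; apply/inCP => t e tab e0.
have e4 : 0 < e / 4 by rewrite divr_gt0.
have [n Xn] := Xx _ e4.
have /inCP /(_ t _ tab e4) [d d0 H] := cX n.
exists d => // s sab sd.
have h1 := Xn s sab; have h2 := Xn t tab; have h3 := H s sab sd.
have -> : x s - x t = - (X n s - x s) + (X n s - X n t) + (X n t - x t).
  by ring.
apply: le_lt_trans (ler_normD _ _) _.
have := ler_normD (- (X n s - x s)) (X n s - X n t); rewrite normrN.
by lra.
Qed.

(** Banach's fixed point theorem for the sup norm on [a, b].  The iterates are
    handled pointwise, since only their restrictions to [a, b] matter. *)
Lemma inC_fixed_point (R : realType) (a b : R) (F : (R -> R) -> R -> R) :
  a < b -> (forall x, inC a b x -> inC a b (F x)) ->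
  (forall x y k, inC a b x -> inC a b y -> 0 <= k ->
    {in `[a, b], forall t, `|x t - y t| <= k} ->
    {in `[a, b], forall t, `|F x t - F y t| <= k / 2}) ->
  exists2 x, inC a b x & {in `[a, b], F x =1 x}.
Proof.
move=> ab FC Fk.
pose X n := iter n F (cst 0).
have XC n : inC a b (X n) by elim: n => [|n ih]; [exact: inC_cst|exact: FC].
have [k k0 Xk] := inC_bounded ab (XC 1%N).
have step n : {in `[a, b], forall t, `|X n.+1 t - X n t| <= k / 2 ^+ n}.
  elim: n => [|n ih] t tab; first by rewrite expr0 divr1 /= subr0; exact: Xk.
  rewrite exprSr invfM mulrA.
  have kn : 0 <= k / 2 ^+ n by rewrite divr_ge0 ?exprn_ge0.
  exact: Fk (XC n.+1) (XC n) kn ih t tab.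
have tail n m : {in `[a, b], forall t,
    `|X (n + m)%N t - X n t| <= 2 * k / 2 ^+ n - 2 * k / 2 ^+ (n + m)}.
  move=> t tab; elim: m => [|m ih]; first by rewrite addn0 !subrr normr0.
  rewrite addnS -(subrKA (X (n + m)%N t)).
  apply: le_trans (ler_normD _ _) _.
  have := step (n + m)%N t tab.
  have -> : 2 * k / 2 ^+ (n + m).+1 = k / 2 ^+ (n + m).
    by rewrite exprS invfM mulrACA divff// mul1r.
  by move: ih; rewrite -[2 * k / 2 ^+ (n + m)]mulrA; lra.
have small e : 0 < e -> exists n, forall m, (n <= m)%N -> 2 * k / 2 ^+ m <= e.
  move=> e0.
  have /cvgrPdist_le /(_ _ e0) [n _ H] :
      geometric (2 * k) (2^-1) @ \oo --> (0 : R).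
    by apply: cvg_geometric; rewrite ger0_norm// invf_lt1// ltr1n.
  exists n => m nm; have := H m nm; rewrite /geometric/= sub0r normrN exprVn.
  by apply: le_trans; exact: ler_norm.
have tail' n m : (n <= m)%N ->
    {in `[a, b], forall t, `|X m t - X n t| <= 2 * k / 2 ^+ n}.
  move=> nm t tab; have := tail n (m - n)%N t tab.
  rewrite subnKC// => /le_trans; apply.
  by rewrite gerBl divr_ge0// ?mulr_ge0// exprn_ge0.
have cvgX t : t \in `[a, b] -> cvgn (fun n => X n t).
  move=> tab; apply/cauchy_cvgP/cauchy_exP => e e0.
  have e2 : 0 < e / 2 by rewrite divr_gt0.
  have [n Hn] := small _ e2.
  exists (X n t); exists n => // m nm; rewrite /ball/= distrC.
  apply: le_lt_trans (tail' n m nm t tab) _.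
  by apply: le_lt_trans (Hn n (leqnn n)) _; lra.
pose x t := limn (fun n => X n t).
have Xx n : {in `[a, b], forall t, `|X n t - x t| <= 2 * k / 2 ^+ n}.
  move=> t tab; rewrite distrC.
  have h : (fun m => `|X m t - X n t|) @ \oo --> `|x t - X n t|.
    by apply: cvg_norm; apply: cvgB; [exact: cvgX|exact: cvg_cst].
  apply: (cvgr_to_le h); exists n => // m nm; exact: tail'.
have xC : inC a b x.
  apply: (inC_uniform_limit XC) => e e0; have [n Hn] := small e e0.
  by exists n => t tab; apply: le_trans (Xx n t tab) (Hn n (leqnn n)).
exists x => // t tab; apply/eqP; rewrite -subr_eq0 -normr_le0.
apply/ler_addgt0Pr => e e0; rewrite add0r.
have e2 : 0 < e / 2 by rewrite divr_gt0.
have [n Hn] := small _ e2.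
have kn : 0 <= 2 * k / 2 ^+ n by rewrite divr_ge0// ?mulr_ge0// exprn_ge0.
have h1 := Fk _ _ _ (XC n) xC kn (Xx n) t tab.
have h2 : `|F (X n) t - x t| <= 2 * k / 2 ^+ n.+1 := Xx n.+1 t tab.
have h3 := Hn n (leqnn n); have h4 := Hn n.+1 (leqnSn n).
rewrite (_ : _ - _ = - (F (X n) t - F x t) + (F (X n) t - x t)); last by ring.
apply: le_trans (ler_normD _ _) _; rewrite normrN.
by lra.
Qed.

(** * Positive operators and the homotopy of the quadratic *)

Lemma is_derive_lin (R : realType) (x y : R -> R) (t dx dy r s : R) :
  is_derive t 1 x dx -> is_derive t 1 y dy ->
  is_derive t 1 (fun u => r * x u + s * y u) (r * dx + s * dy).
Proof.
by move=> hx hy; exact: is_deriveD (is_deriveZ r hx) (is_deriveZ s hy).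
Qed.

Lemma ae_and (R : realType) (P Q : R -> Prop) :
  {ae lebesgue_measure, forall t, P t} ->
  {ae lebesgue_measure, forall t, Q t} ->
  {ae lebesgue_measure, forall t, P t /\ Q t}.
Proof. exact: ae_mono2. Qed.

(** Null sets of the restricted measure may contain anything outside [a, b]. *)
Lemma ae_leb_itv (R : realType) (a b : R) (P : R -> Prop) :
  (\forall t \ae leb_itv a b, P t) ->
  {ae lebesgue_measure, forall t, t \in `[a, b] -> P t}.
Proof.
move=> [N [mN N0 PN]]; exists (N `&` `[a, b]); split => //.
  exact: measurableI.
move=> t /= /not_implyP [tab nPt]; split => //; exact: PN.
Qed.

Lemma opnorm_le (R : realType) (a b n : R) (T : (R -> R) -> R -> R) :
  opnorm a b T = n%:E ->
  {ae lebesgue_measure, forall t, t \in `[a, b] -> T (cst 1) t <= n}.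
Proof.
move=> Tn; have : (opnorm a b T <= n%:E)%E by rewrite Tn.
by move=> /ess_supP/ae_leb_itv; apply: ae_mono => t h /h; rewrite lee_fin.
Qed.

Lemma leb_itvT (R : realType) (a b : R) : a < b -> (0 < leb_itv a b [set: R])%E.
Proof.
move=> ab.
by rewrite /mrestr setTI lebesgue_measure_itv/= lte_fin ab lte_fin subr_gt0.
Qed.

Lemma Loo_L (R : realType) (a b : R) (f : R -> R) : a < b ->
  inLoo a b f -> inL a b f.
Proof.
move=> ab [mf ff]; move: ff; rewrite /finite_norm unlock leb_itvT// => ff.
have [K K0 fK] : exists2 K, 0 <= K &
    {ae lebesgue_measure, forall t, t \in `[a, b] -> `|f t| <= K}.
  have [K /ae_leb_itv fK] := ess_supr_bounded ff; exists `|K| => //.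
  by apply: ae_mono fK => t h tab; apply: le_trans (h tab) (ler_norm K).
apply/integrableP; split; first exact/measurable_realfun.measurable_EFinP.
apply: (@le_lt_trans _ _ (\int[lebesgue_measure]_(t in `[a, b]) K%:E)%E).
  apply: ae_ge0_le_integral => //.
  exact/measurable_realfun.measurable_EFinP/measurableT_comp.
rewrite integral_cst//= lebesgue_measure_itv/=; case: ifP => // _.
  by rewrite -EFinD -EFinM ltry.
by rewrite mule0.
Qed.

(** Apply positivity to M - x and to m + x. *)
Lemma positive_operator_bound (R : realType) (a b n m M : R)
  (T : (R -> R) -> R -> R) (x : R -> R) :
  linear_positive_operator a b T ->
  {ae lebesgue_measure, forall t, t \in `[a, b] -> T (cst 1) t <= n} ->
  inC a b x -> 0 <= m -> 0 <= M ->
  {in `[a, b], forall t, - m <= x t <= M} ->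
  {ae lebesgue_measure, forall t, t \in `[a, b] -> - (n * m) <= T x t <= n * M}.
Proof.
move=> [_ linT posT] Tn xC m0 M0 xmM.
have c1 := @inC_cst R a b 1.
have lin1 := linT M (-1) _ _ c1 xC; have lin2 := linT m 1 _ _ c1 xC.
have pos1 : {ae lebesgue_measure, forall t, t \in `[a, b] ->
    0 <= T (fun u => M * cst 1 u + -1 * x u) t}.
  apply: posT (inC_lin c1 xC) _ => t /xmM /andP[? ?] /=; lra.
have pos2 : {ae lebesgue_measure, forall t, t \in `[a, b] ->
    0 <= T (fun u => m * cst 1 u + 1 * x u) t}.
  apply: posT (inC_lin c1 xC) _ => t /xmM /andP[? ?] /=; lra.
have := ae_and Tn (ae_and (ae_and lin1 lin2) (ae_and pos1 pos2)).
apply: ae_mono => t [H1 [[H2 H3] [H4 H5]]] tab.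
move: (H4 tab) (H5 tab); rewrite H2// H3// => h4 h5; have h1 := H1 tab.
have : M * T (cst 1) t <= M * n by rewrite ler_wpM2l.
have : m * T (cst 1) t <= m * n by rewrite ler_wpM2l.
by move=> *; apply/andP; split; lra.
Qed.

Lemma chi_continuous (R : realType) (A B : R) (D : set R) :
  {within D, continuous (chi A B)}.
Proof.
have -> : chi A B = horner ((B ^+ 2 - A ^+ 2) *: 'X^2 +
    (A ^+ 2 - B ^+ 2 + B) *: 'X + (1 - A)%:P).
  by apply/funext => t; rewrite /chi !hornerE.
by apply: continuous_subspaceT => t; exact: continuous_horner.
Qed.

(** In l the quadratic reads 1 - l (A - B s) - l^2 k with
    k = (B^2 - A^2) s (1 - s).  If k >= 0 it is concave, hence at least the
    smaller of its values 1 at l = 0 and chi A B s at l = 1.  If k < 0 it is at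
    least 1 - A, the value of chi A B at 0. *)
Lemma chi_homotopy (R : realType) (A B : R) : 0 <= A -> 0 <= B ->
  (forall t, 0 <= t <= 1 -> 0 < chi A B t) ->
  exists2 d, 0 < d & forall l s, 0 <= l <= 1 -> 0 <= s <= 1 ->
    d <= chi (l * A) (l * B) s.
Proof.
move=> A0 B0 chi0.
have [s0 s0I smin] := EVT_min ler01 (@chi_continuous R A B `[0, 1]).
have c0 : 0 < chi A B s0 by apply: chi0; move: s0I; rewrite in_itv.
exists (Num.min 1 (chi A B s0)); first by rewrite lt_min ltr01.
move=> l s /andP[l0 l1] sI; have /andP[s_0 s_1] := sI.
have h1 : Num.min 1 (chi A B s0) <= 1 by rewrite ge_min lexx.
have h2 t : 0 <= t <= 1 -> Num.min 1 (chi A B s0) <= chi A B t.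
  by move=> tI; rewrite ge_min (smin t) ?orbT// in_itv.
move: (h2 0) (h2 s sI); rewrite lexx ler01 => /(_ isT).
move: (Num.min _ _) h1 => d d1.
rewrite (_ : chi A B 0 = 1 - A); last by rewrite /chi; ring.
have -> : chi A B s = 1 - A + B * s - (B ^+ 2 - A ^+ 2) * (s * (1 - s)).
  by rewrite /chi; ring.
have -> : chi (l * A) (l * B) s = 1 - l * A + l * (B * s) -
    l * (l * ((B ^+ 2 - A ^+ 2) * (s * (1 - s)))).
  by rewrite /chi; ring.
move: ((_ - _) * _) => k.
have Bs0 : 0 <= B * s by rewrite mulr_ge0.
move: (B * s) Bs0 => Bs Bs0 dA ds.
have lA : l * A <= A by rewrite ler_piMl.
have lBs : 0 <= l * Bs by rewrite mulr_ge0.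
have [k0|k0] := leP 0 k.
- have lk : l * (l * k) <= l * k by rewrite ler_piMl ?mulr_ge0.
  have l'0 : 0 <= 1 - l by lra.
  have hd : l * d <= l * (1 - A + Bs - k) by rewrite ler_wpM2l.
  have hd' : (1 - l) * d <= (1 - l) * 1 by rewrite ler_wpM2l.
  lra.
- have : l * (l * k) <= 0 by rewrite !mulr_ge0_le0// ltW.
  lra.
Qed.

(** * Unique solvability by continuation *)

Section continuation.
Context {R : realType}.
Variables (a b p q : R) (P M : (R -> R) -> R -> R).
Hypotheses (ab : a < b) (p0 : 0 <= p) (q0 : 0 <= q).
Hypotheses (lpoP : linear_positive_operator a b P).
Hypotheses (lpoM : linear_positive_operator a b M).
Hypothesis P1 :
  {ae lebesgue_measure, forall t, t \in `[a, b] -> P (cst 1) t <= p}.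
Hypothesis M1 :
  {ae lebesgue_measure, forall t, t \in `[a, b] -> M (cst 1) t <= q}.

Let ba0 : 0 <= b - a. Proof. by rewrite subr_ge0 ltW. Qed.

Let A := (b - a) * p.
Let B := (b - a) * q.

Let solves l f x := {ae lebesgue_measure, forall t, t \in `[a, b] ->
  is_derive t 1 x (l * (P x t - M x t) + f t)}.

Lemma difference_bound (x : R -> R) (k : R) : inC a b x -> 0 <= k ->
  {in `[a, b], forall t, `|x t| <= k} ->
  {ae lebesgue_measure, forall t, t \in `[a, b] ->
    `|P x t - M x t| <= (p + q) * k}.
Proof.
move=> xC k0 xk.
have xkk : {in `[a, b], forall t, - k <= x t <= k}.
  by move=> t tab; rewrite -ler_norml; exact: xk.
have := ae_and (positive_operator_bound lpoP P1 xC k0 k0 xkk)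
               (positive_operator_bound lpoM M1 xC k0 k0 xkk).
apply: ae_mono => t [h1 h2] tab.
have /andP[? ?] := h1 tab; have /andP[? ?] := h2 tab.
by rewrite ler_norml; apply/andP; split; lra.
Qed.

Lemma difference_sub (x y : R -> R) : inC a b x -> inC a b y ->
  {ae lebesgue_measure, forall t, t \in `[a, b] ->
    P (fun u => 1 * x u + -1 * y u) t - M (fun u => 1 * x u + -1 * y u) t =
    (P x t - M x t) - (P y t - M y t)}.
Proof.
move=> xC yC; have [[_ linP _] [_ linM _]] := (lpoP, lpoM).
have := ae_and (linP 1 (-1) _ _ xC yC) (linM 1 (-1) _ _ xC yC).
by apply: ae_mono => t [h1 h2] tab; rewrite h1// h2//; ring.
Qed.

Lemma difference_ext (x y : R -> R) : inC a b x -> inC a b y ->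
  {in `[a, b], x =1 y} ->
  {ae lebesgue_measure, forall t, t \in `[a, b] ->
    P x t - M x t = P y t - M y t}.
Proof.
move=> xC yC xy; have [[[extP _] _ _] [[extM _] _ _]] := (lpoP, lpoM).
have := ae_and (extP _ _ xC yC xy) (extM _ _ xC yC xy).
by apply: ae_mono => t [h1 h2] tab; rewrite h1// h2.
Qed.

Lemma difference_L (x : R -> R) : inC a b x -> inL a b (fun t => P x t - M x t).
Proof.
move=> xC; have [[[_ PL] _ _] [[_ ML] _ _]] := (lpoP, lpoM).
have := Loo_L ab (PL _ xC); have := Loo_L ab (ML _ xC); rewrite /inL => iM iP.
have -> : EFin \o (fun t => P x t - M x t) = ((EFin \o P x) \- (EFin \o M x))%E.
  by apply/funext.
exact: integrableB.
Qed.

(** The a priori bound for the operators l P and l M, with a constant free of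
    [l]. *)
Lemma homotopy_bound (l d eps : R) (w h : R -> R) : 0 <= l <= 1 -> 0 < d ->
  (forall s, 0 <= s <= 1 -> d <= chi (l * A) (l * B) s) -> 0 <= eps ->
  inAC a b w -> w a = 0 -> solves l h w ->
  {ae lebesgue_measure, forall t, t \in `[a, b] -> `|h t| <= eps} ->
  {in `[a, b], forall t, `|w t| <= (1 + B) ^+ 2 / d ^+ 2 * ((b - a) * eps)}.
Proof.
move=> /andP[l0 l1] d0 dchi eps0 ACw wa wE heps t tab.
have B0 : 0 <= B by exact: mulr_ge0.
have := @apriori_bound R a b (l * p) (l * q) eps d w _ ab
  (mulr_ge0 l0 p0) (mulr_ge0 l0 q0) eps0 d0.
rewrite !(mulrCA (b - a) l) -/A -/B => /(_ _ dchi ACw wa wE) bound.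
apply: le_trans (bound _ t tab) _.
- move=> K m K0 m0 wmK.
  have := ae_and heps (ae_and
     (positive_operator_bound lpoP P1 (AC_inC ACw) m0 K0 wmK)
     (positive_operator_bound lpoM M1 (AC_inC ACw) m0 K0 wmK)).
  apply: ae_mono => u [h1 [h2 h3]] uab.
  have := h1 uab; rewrite ler_norml => /andP[? ?].
  have /andP[? ?] := h2 uab; have /andP[? ?] := h3 uab.
  have up : l * (P w u - M w u) <= l * (p * K + q * m).
    by rewrite ler_wpM2l//; lra.
  have dn : l * (- (p * m + q * K)) <= l * (P w u - M w u).
    by rewrite ler_wpM2l//; lra.
  by apply/andP; split; lra.
- rewrite ler_wpM2r ?mulr_ge0//.
  rewrite ler_wpM2r ?invr_ge0 ?exprn_ge0 ?(ltW d0)//.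
  rewrite ler_sqr ?nnegrE ?addr_ge0 ?mulr_ge0//.
  by rewrite lerD2l ler_piMl.
Qed.

Let solvable l := forall f c, inL a b f ->
  exists x, [/\ inAC a b x, x a = c & solves l f x].

Lemma solvable0 : solvable 0.
Proof.
move=> f c fL; have [ACF FE] := AC_primitive fL.
set F := fun t => _ in ACF FE.
exists (fun t => 1 * F t + c * cst 1 t); split.
- apply: AC_lin ACF _; apply: (@lipschitz_AC _ _ _ 0) => s t _ _ _.
  by rewrite subrr normr0 mul0r.
- rewrite /F set_itv1 Rintegral_set1 /cst; ring.
- apply: ae_mono FE => t h tab; rewrite mul0r add0r.
  have cst' : is_derive t 1 (cst (1 : R)) (0 : R) by exact: is_derive_cst.
  have := is_derive_lin 1 c (h tab) cst'.
  by rewrite mul1r mulr0 addr0.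
Qed.

(** A solution for l + r is a fixed point of the map sending v to the solution
    of x' = l (P - M) x + r (P - M) v + f; by the a priori bound this map
    contracts distances by a factor 1/2 when r is small. *)
Lemma solvable_step (l r d : R) : 0 <= l <= 1 -> 0 <= r -> 0 < d ->
  (forall s, 0 <= s <= 1 -> d <= chi (l * A) (l * B) s) ->
  (1 + B) ^+ 2 / d ^+ 2 * (b - a) * (p + q) * r <= 1 / 2 ->
  solvable l -> solvable (l + r).
Proof.
move=> lI r0 d0 dchi small solv f c fL.
have fvL v : inC a b v -> inL a b (fun t => r * (P v t - M v t) + f t).
  move=> vC.
  have := difference_L vC; move: fL; rewrite /inL => fL iD.
  have -> : EFin \o (fun t => r * (P v t - M v t) + f t) =
      ((fun t => r%:E * (P v t - M v t)%R%:E) \+ (EFin \o f))%E.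
    by apply/funext.
  by apply: integrableD => //; exact: integrableZl.
have /choice[F FE] : forall v, exists x, inC a b v -> [/\ inAC a b x, x a = c &
    solves l (fun t => r * (P v t - M v t) + f t) x].
  move=> v; have [vC|] := pselect (inC a b v); last by exists v.
  by have [x xE] := solv _ c (fvL v vC); exists x.
have FC v : inC a b v -> inC a b (F v) by move=> /FE[/AC_inC].
have [|x xC Fx] := inC_fixed_point ab FC.
  move=> x y k xC yC k0 xyk t tab.
  have [ACx xa xE] := FE x xC; have [ACy ya yE] := FE y yC.
  pose w u := 1 * F x u + -1 * F y u.
  pose z u := 1 * x u + -1 * y u.
  have zC : inC a b z by exact: inC_lin.
  have zk : {in `[a, b], forall u, `|z u| <= k}.
    by move=> u uab; rewrite /z mul1r mulN1r; exact: xyk.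
  have eps0 : 0 <= r * ((p + q) * k) by rewrite !(mulr_ge0, addr_ge0).
  have zeps : {ae lebesgue_measure, forall u, u \in `[a, b] ->
      `|r * (P z u - M z u)| <= r * ((p + q) * k)}.
    apply: ae_mono (difference_bound zC k0 zk) => u h uab.
    by rewrite normrM ger0_norm// ler_wpM2l// h.
  have wE : solves l (fun u => r * (P z u - M z u)) w.
    have := ae_and (ae_and xE yE) (ae_and (difference_sub xC yC)
      (difference_sub (FC _ xC) (FC _ yC))).
    apply: ae_mono => u [[h1 h2] [h3 h4]] uab.
    apply: is_derive_eq (is_derive_lin 1 (-1) (h1 uab) (h2 uab)) _.
    by rewrite h3// h4//; ring.
  have wa : w a = 0 by rewrite /w xa ya; ring.
  have := homotopy_bound lI d0 dchi eps0 (AC_lin 1 (-1) ACx ACy) wa wE zeps tab.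
  rewrite /w mul1r mulN1r => /le_trans; apply.
  set C := (1 + B) ^+ 2 / d ^+ 2 in small *.
  rewrite (_ : C * _ = C * (b - a) * (p + q) * r * k); last by ring.
  apply: le_trans (ler_wpM2r k0 small) _.
  by rewrite mulrC mul1r.
have [ACFx Fxa FxE] := FE x xC; exists (F x); split => //.
have := ae_and FxE (difference_ext (FC _ xC) xC Fx).
apply: ae_mono => t [h1 h2] tab.
by apply: is_derive_eq (h1 tab) _; rewrite h2//; ring.
Qed.

(** The step size allowed by [solvable_step] does not depend on [l], so that N
    equal steps lead from 0 to 1. *)
Lemma chi_pos_solvable :
  (forall t, 0 <= t <= 1 -> 0 < chi A B t) -> uniquely_solvable a b P M.
Proof.
have A0 : 0 <= A by exact: mulr_ge0.
have B0 : 0 <= B by exact: mulr_ge0.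
move=> /(chi_homotopy A0 B0)[d d0 dchi] f c fL.
have I1 : 0 <= (1 : R) <= 1 by rewrite ler01 lexx.
have solv1 : solvable 1.
  pose C := (1 + B) ^+ 2 / d ^+ 2 * (b - a) * (p + q).
  have C0 : 0 <= C.
    apply: mulr_ge0; last exact: addr_ge0.
    apply: mulr_ge0 => //; apply: divr_ge0; apply: exprn_ge0; last exact: ltW.
    exact: addr_ge0.
  pose N := (Num.bound (2 * C)).+1.
  have N0 : 0 < N%:R :> R by rewrite ltr0n.
  have CN : C * N%:R^-1 <= 1 / 2.
    have : 2 * C <= N%:R.
      have C20 : 0 <= 2 * C by rewrite mulr_ge0.
      by apply: (le_trans (ltW (archi_boundP C20))); rewrite ler_nat leqnSn.
    by move=> ?; rewrite ler_pdivrMr//; lra.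
  suff H k : (k <= N)%N -> solvable (k%:R / N%:R).
    by have := H N (leqnn N); rewrite divff// gt_eqF.
  elim: k => [|k ih] kN; first by rewrite mul0r; exact: solvable0.
  rewrite -natr1 mulrDl div1r.
  have kI : 0 <= (k%:R / N%:R : R) <= 1.
    by rewrite divr_ge0//= ler_pdivrMr// mul1r ler_nat ltnW.
  apply: (solvable_step kI _ d0) => //; first by move=> s; exact: dchi.
  exact: ih (ltnW kN).
have [x [ACx xa xE]] := solv1 f c fL.
exists x.
  split => //; apply: ae_mono xE => t h tab.
  by have := h tab; rewrite mul1r.
move=> y [ACy ya yE] t tab; apply/eqP; rewrite -subr_eq0 -normr_le0.
pose w u := 1 * x u + -1 * y u.
have ACw : inAC a b w by exact: AC_lin.
have wa : w a = 0 by rewrite /w xa ya; ring.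
have wE : solves 1 (cst 0) w.
  have := ae_and (ae_and xE yE) (difference_sub (AC_inC ACx) (AC_inC ACy)).
  apply: ae_mono => u [[h1 h2] h3] uab.
  apply: is_derive_eq (is_derive_lin 1 (-1) (h1 uab) (h2 uab)) _.
  by rewrite h3// /cst; ring.
have h0 : {ae lebesgue_measure, forall u, u \in `[a, b] -> `|cst 0 u : R| <= 0}.
  by apply: ae_mono (ae_neq a) => u _ _; rewrite normr0.
have := homotopy_bound I1 d0 (fun s => dchi 1 s I1) (lexx 0) ACw wa wE h0 tab.
by rewrite !mulr0 /w mul1r mulN1r.
Qed.

End continuation.

(** * Necessity: extremal operators with piecewise linear solutions *)

(** On each of the two pieces x' is constant for such operators, which makes the
    homogeneous problem a finite linear system. *)
Definition switch_eval (R : realType) (n tau u v : R) (x : R -> R) (t : R) :=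
  n * x (if t <= tau then u else v).

Lemma switch_eval_linear_positive (R : realType) (a b n tau u v : R) :
  0 <= n -> u \in `[a, b] -> v \in `[a, b] ->
  linear_positive_operator a b (switch_eval n tau u v).
Proof.
move=> n0 uab vab.
have ae_all (Q : R -> Prop) : (forall t, Q t) ->
    {ae lebesgue_measure, forall t, t \in `[a, b] -> Q t}.
  by move=> Qt; apply: ae_mono (ae_neq a) => t _ _; exact: Qt.
split; [split|..].
- move=> x y _ _ xy; apply: ae_all => t; rewrite /switch_eval.
  by case: ifP => _; rewrite xy.
- move=> x _; split.
  + rewrite /switch_eval; apply: measurable_funTS.
    have -> : (fun t => n * x (if t <= tau then u else v)) =
        (fun t => if t <= tau then n * x u else n * x v).
      by apply/funext => t; case: ifP.
    apply: measurable_fun_ifT => //.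
    exact: measurable_realfun.measurable_fun_ler.
  + rewrite /finite_norm unlock; case: ifP => // _.
    apply: le_lt_trans (ltry (`|n * x u| + `|n * x v|)).
    apply: ess_sup_ler => t; rewrite lee_fin /switch_eval.
    by case: ifP => _; rewrite ?lerDl ?lerDr.
- move=> r s x y _ _; apply: ae_all => t.
  by rewrite /switch_eval mulrDr !(mulrCA n).
- move=> x _ x0; apply: ae_all => t.
  by rewrite /switch_eval mulr_ge0//; case: ifP => _; exact: x0.
Qed.

Lemma switch_eval_opnorm (R : realType) (a b n tau u v : R) : a < b ->
  opnorm a b (switch_eval n tau u v) = n%:E.
Proof.
move=> ab; rewrite /opnorm (_ : EFin \o _ = EFin \o cst n).
  by apply: ess_sup_cstr; exact: leb_itvT.
by apply/funext => t; rewrite /= /switch_eval /cst mulr1.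
Qed.

(** The comparison solution is 0 x + 0 x rather than the constant 0: linearity
    gives the operators on it directly, almost everywhere. *)
Lemma homogeneous_solution_zero (R : realType) (a b : R)
    (P M : (R -> R) -> R -> R) (x : R -> R) :
  linear_positive_operator a b P -> linear_positive_operator a b M ->
  uniquely_solvable a b P M -> inAC a b x -> x a = 0 ->
  {ae lebesgue_measure, forall t, t \in `[a, b] ->
    is_derive t 1 x (P x t - M x t)} ->
  {in `[a, b], forall t, x t = 0}.
Proof.
move=> [_ linP _] [_ linM _] uniq ACx xa xE t tab.
have L0 : inL a b (cst 0) by exact: integrable0.
have [y _ yu] := uniq (cst 0) 0 L0.
have xC := AC_inC ACx.
pose z u := 0 * x u + 0 * x u.
have solx : is_solution a b P M (cst 0) 0 x.
  by split => //; apply: ae_mono xE => u h uab; rewrite addr0; exact: h.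
have solz : is_solution a b P M (cst 0) 0 z.
  split; first exact: AC_lin.
  - by rewrite /z !mul0r addr0.
  - have := ae_and xE (ae_and (linP 0 0 _ _ xC xC) (linM 0 0 _ _ xC xC)).
    apply: ae_mono => u [h1 [h2 h3]] uab.
    apply: is_derive_eq (is_derive_lin 0 0 (h1 uab) (h1 uab)) _.
    by rewrite h2// h3// /cst; ring.
by rewrite -(yu _ solx t tab) (yu _ solz t tab) /z !mul0r addr0.
Qed.

Lemma is_derive_affine (R : realType) (x : R -> R) (t k r : R) : 0 < r ->
  (forall u, `|u - t| < r -> x u = x t + k * (u - t)) -> is_derive t 1 x k.
Proof.
move=> r0 xE.
have cv : (fun h => h^-1 *: (x (h *: 1 + t) - x t)) @ 0^' --> k.
  apply/cvgrPdist_lt => e e0; apply/nbhs_ballP; exists r => //= h.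
  rewrite /ball/= sub0r normrN => hr h0.
  rewrite /GRing.scale/= mulr1 xE addrK// addrAC subrr add0r.
  by rewrite mulrCA mulVf// mulr1 subrr normr0.
split; first exact: (cvgP _ cv).
exact: cvg_lim cv.
Qed.

(** The function vanishing at a with slope [al] before [tau] and [al + be] after
    it, for a <= tau. *)
Definition ramp (R : realType) (a tau al be t : R) : R :=
  al * (t - a) + be * Num.max 0 (t - tau).

Lemma ramp_AC (R : realType) (a b c tau al be : R) :
  inAC a b (ramp c tau al be).
Proof.
apply: (@lipschitz_AC _ _ _ (`|al| + `|be|)) => s t _ st _.
have -> : ramp c tau al be t - ramp c tau al be s =
    al * (t - s) + be * (Num.max 0 (t - tau) - Num.max 0 (s - tau)).
  by rewrite /ramp; ring.
apply: le_trans (ler_normD _ _) _; rewrite !normrM mulrDl.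
rewrite [`|t - s|]ger0_norm ?subr_ge0// lerD2l ler_wpM2l//.
rewrite ler_norml; apply/andP.
by have [?|?] := leP 0 (t - tau); have [?|?] := leP 0 (s - tau); split; lra.
Qed.

Lemma ramp_derive (R : realType) (a tau al be t : R) : t != tau ->
  is_derive t 1 (ramp a tau al be) (if t <= tau then al else al + be).
Proof.
move=> ttau; have r0 : 0 < `|t - tau| by rewrite normr_gt0 subr_eq0.
apply: (is_derive_affine r0) => u; rewrite /ramp.
have [tt|tt] := leP t tau.
- rewrite (ler0_norm (_ : t - tau <= 0)); last by rewrite subr_le0.
  rewrite ltr_norml => /andP[? ?].
  by rewrite !max_l; [ring|lra|lra].
- rewrite (gtr0_norm (_ : 0 < t - tau)); last by rewrite subr_gt0.
  rewrite ltr_norml => /andP[? ?].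
  by rewrite !max_r; [ring|lra|lra].
Qed.

Section necessity.
Context {R : realType}.
Variables (a b p q : R).
Hypotheses (ab : a < b) (p0 : 0 <= p) (q0 : 0 <= q).
Let A := (b - a) * p.
Let B := (b - a) * q.

Let always_solvable := forall Tp Tm : (R -> R) -> R -> R,
  linear_positive_operator a b Tp -> linear_positive_operator a b Tm ->
  opnorm a b Tp = p%:E -> opnorm a b Tm = q%:E -> uniquely_solvable a b Tp Tm.

Let aab : a \in `[a, b]. Proof. by rewrite in_itv/= lexx ltW. Qed.
Let bab : b \in `[a, b]. Proof. by rewrite in_itv/= lexx ltW. Qed.

(** A ramp solves the homogeneous problem as soon as its two slopes are
    consistent with its own values at the evaluation points. *)
Lemma switch_eval_ramp_zero (tau u v u' v' al be : R) : always_solvable ->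
  u \in `[a, b] -> v \in `[a, b] -> u' \in `[a, b] -> v' \in `[a, b] ->
  a <= tau ->
  let x := ramp a tau al be in
  al = p * x u - q * x u' -> al + be = p * x v - q * x v' ->
  {in `[a, b], forall t, x t = 0}.
Proof.
move=> solv uab vab u'ab v'ab atau x alE beE.
have lp := switch_eval_linear_positive tau p0 uab vab.
have lq := switch_eval_linear_positive tau q0 u'ab v'ab.
apply: (homogeneous_solution_zero lp lq) => //.
- by apply: solv => //; exact: switch_eval_opnorm.
- exact: ramp_AC.
- by rewrite /x /ramp subrr mulr0 add0r max_l ?subr_le0// mulr0.
- apply: ae_mono (ae_neq tau) => t ttau tab.
  apply: is_derive_eq (ramp_derive a al be ttau) _.
  by rewrite /switch_eval; case: ifP => _.
Qed.

Lemma necessary_A_lt1 : always_solvable -> A < 1.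
Proof.
move=> solv; rewrite ltNge; apply/negP => A1.
have p_gt0 : 0 < p.
  rewrite lt_neqAle p0 andbT; apply/eqP => pE.
  by move: A1; rewrite /A -pE mulr0 ler10.
pose tau := a + p^-1.
have tauab : tau \in `[a, b].
  rewrite in_itv/= lerDl invr_ge0 p0/= -lerBrDl -[_^-1]mul1r ler_pdivrMr//.
have xtau : ramp a tau p 0 tau = 1.
  by rewrite /ramp mul0r addr0 /tau addrAC subrr add0r divff// gt_eqF.
have xa : ramp a tau p 0 a = 0.
  by rewrite /ramp mul0r addr0 subrr mulr0.
have atau : a <= tau by move: tauab; rewrite in_itv/= => /andP[].
have := switch_eval_ramp_zero (al := p) (be := 0) solv tauab tauab aab aab atau.
rewrite /= xtau xa mulr0 subr0 mulr1 addr0 => /(_ erefl erefl tau tauab).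
by rewrite xtau => /eqP; rewrite oner_eq0.
Qed.

(** At a zero s of the quadratic the extremal system is degenerate.  Its kernel
    is spanned by x1 = B s, x2 = - (1 - A s), the values of the solution at
    tau = a + (b - a) s and at b; the extremum at tau is felt by Tp on [a, tau]
    and by Tm on ]tau, b], the one at b the other way round. *)
Lemma necessary_chi_pos : always_solvable ->
  forall t, 0 <= t <= 1 -> 0 < chi A B t.
Proof.
move=> solv t /andP[t0 t1]; have A1 := necessary_A_lt1 solv.
have ba0 : 0 < b - a by rewrite subr_gt0.
have A0 : 0 <= A by rewrite mulr_ge0// ltW.
have B0 : 0 <= B by rewrite mulr_ge0// ltW.
rewrite ltNge; apply/negP => chit.
have [s sI chis] : exists2 s, s \in `[0, t] & chi A B s = 0.
  apply: IVT => //; first exact: chi_continuous.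
  have chi0 : 0 <= chi A B 0 by rewrite chiE; lra.
  by rewrite ge_min le_max chit chi0 orbT.
move: sI; rewrite in_itv/= => /andP[s0 st]; have s1 := le_trans st t1.
have As : 0 < 1 - A * s.
  have : A * s <= A by rewrite ler_piMr.
  lra.
have sn0 : s != 0.
  by apply/eqP => sE; move: chis; rewrite sE chiE; lra.
pose tau := a + (b - a) * s.
have tauab : tau \in `[a, b].
  rewrite in_itv/= lerDl mulr_ge0 ?(ltW ba0)//= -lerBrDl.
  by rewrite ler_piMr// ltW.
have atau : a <= tau by move: tauab; rewrite in_itv/= => /andP[].
have taub : tau <= b by move: tauab; rewrite in_itv/= => /andP[].
pose x1 := B * s; pose x2 := - (1 - A * s).
pose al := p * x1 - q * x2.
pose be := p * x2 - q * x1 - al.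
have beE : al + be = p * x2 - q * x1 by rewrite /be; ring.
have xtau : ramp a tau al be tau = x1.
  rewrite /ramp subrr max_l// mulr0 addr0 /tau /al /x1 /x2 /A /B; ring.
have xb : ramp a tau al be b = x2.
  apply/eqP; rewrite -subr_eq0; apply/eqP; rewrite -[RHS]chis.
  rewrite /ramp max_r ?subr_ge0// chiE /be /al /x1 /x2 /tau /A /B; ring.
have := switch_eval_ramp_zero (al := al) (be := be)
  solv tauab bab bab tauab atau.
rewrite /= xtau xb => /(_ erefl beE b bab).
by rewrite xb /x2; lra.
Qed.
End necessity.

Theorem theorem2 (R : realType) (a b : R) (hab : a < b) (normp normm : R)
    (hp : 0 <= normp) (hm : 0 <= normm) :
  let A := (b - a) * normp in
  let B := (b - a) * normm in
  (forall Tp Tm : (R -> R) -> R -> R,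
     linear_positive_operator a b Tp -> linear_positive_operator a b Tm ->
     opnorm a b Tp = normp%:E -> opnorm a b Tm = normm%:E ->
     uniquely_solvable a b Tp Tm) <->
  (forall t : R, 0 <= t <= 1 ->
     0 < (B ^+ 2 - A ^+ 2) * t ^+ 2 + (A ^+ 2 - B ^+ 2 + B) * t + 1 - A).
Proof.
move=> A B; split.
- exact: necessary_chi_pos.
- move=> chi_pos Tp Tm lp lm /opnorm_le Tp1 /opnorm_le Tm1.
  exact: chi_pos_solvable chi_pos.
Qed.
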